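(* Define $$\mathcal{A} = \bigl\{ A^{\mathrm T}\boldsymbol{\alpha} \,\big|\, \boldsymbol{\alpha}\in(0,1)^{|\Omega|},\ \boldsymbol{\alpha}^{\mathrm T}\mathbf{1}_{|\Omega|}=1 \bigr\}\subset\mathbb{R}^d .$$ Then every $\boldsymbol{\gamma}\in\mathcal{A}$ is achievable, i.e. there exists a finite parameter vector $\boldsymbol{r}^{\mathrm{opt}}\in\mathbb{R}^d$ such that $A^{\mathrm T}\boldsymbol{\pi}(\boldsymbol{r}^{\mathrm{opt}})=\boldsymbol{\gamma}$. Furthermore, if $B\in\mathbb{R}^{n\times d}$ with $n\le d$, then for every $$\boldsymbol{\gamma}'\in\bigl\{ BA^{\mathrm T}\boldsymbol{\alpha}\,\big|\,\boldsymbol{\alpha}\in(0,1)^{|\Omega|},\ \boldsymbol{\alpha}^{\mathrm T}\mathbf{1}_{|\Omega|}=1\bigr\}$$ there exists a finite $\boldsymbol{r}^{\mathrm{opt}}\in\mathbb{R}^d$ such that $BA^{\mathrm T}\boldsymbol{\pi}(\boldsymbol{r}^{\mathrm{opt}})=\boldsymbol{\gamma}'$.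
   Context: Consider an irreducible, reversible continuous-time Markov process on a finite state space $\Omega$ with $d>0$ configurable transition rates, whose logarithms are collected in a parameter vector $\boldsymbol{r}\in\mathbb{R}^d$ (all values in $\mathbb{R}^d$ are allowed). Its steady-state distribution has the product form $$\boldsymbol{\pi}(\boldsymbol{r})=\frac{1}{Z(\boldsymbol{r})}\exp(A\boldsymbol{r}+\boldsymbol{b}),\qquad Z(\boldsymbol{r})=\mathbf{1}_{|\Omega|}^{\mathrm T}\exp(A\boldsymbol{r}+\boldsymbol{b}),\qquad \boldsymbol{r}\in\mathbb{R}^d,$$ where $A\in\mathbb{R}^{|\Omega|\times d}$ and $\boldsymbol{b}\in\mathbb{R}^{|\Omega|}$ are fixed (rows of $A$ and entries of $\boldsymbol b$ are indexed by the states), $\exp$ is applied component-wise, and $\mathbf{1}_n$ is the $n$-dimensional all-ones vector. A target $\boldsymbol{\gamma}\in\mathbb{R}^d$ is called achievable if there exists a finite $\boldsymbol{r}^{\mathrm{opt}}\in\mathbb{R}^d$ with $A^{\mathrm T}\boldsymbol{\pi}(\boldsymbol{r}^{\mathrm{opt}})=\boldsymbol{\gamma}$. *)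

(* Defs.v *)
From HB Require Import structures.
From mathcomp Require Import all_boot all_order all_algebra.
From mathcomp Require Import all_classical all_reals all_analysis.

Set Implicit Arguments.
Unset Strict Implicit.
Unset Printing Implicit Defensive.

Import Order.TTheory GRing.Theory Num.Theory.

Local Open Scope classical_set_scope.
Local Open Scope ring_scope.

Definition expv (R : realType) (m : nat) (v : 'cV[R]_m) : 'cV[R]_m :=
  map_mx expR v.

Definition ones (R : realType) (m : nat) : 'cV[R]_m := const_mx 1.

(* A continuous-time Markov process on a finite state space is represented by
   its generator: Q x y is the transition rate from x to y <> x, and the
   diagonal entries make every row sum to 0. *)
Definition is_generator (R : realType) (N : nat) (Q : 'M[R]_N) : Prop :=
  (forall x y, x != y -> 0 <= Q x y) /\ Q *m ones R N = 0.

Definition irreducible_gen (R : realType) (N : nat) (Q : 'M[R]_N) : Prop :=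
  forall x y : 'I_N, connect (fun u v => 0 < Q u v) x y.

Definition is_distribution (R : realType) (N : nat) (p : 'cV[R]_N) : Prop :=
  (forall x, 0 <= p x 0) /\ (p^T *m ones R N) 0 0 = 1.

Definition steady_state (R : realType) (N : nat) (Q : 'M[R]_N)
    (p : 'cV[R]_N) : Prop :=
  is_distribution p /\ p^T *m Q = 0.

Definition reversible_gen (R : realType) (N : nat) (Q : 'M[R]_N)
    (p : 'cV[R]_N) : Prop :=
  forall x y, p x 0 * Q x y = p y 0 * Q y x.

Definition partition_function (R : realType) (N d : nat) (A : 'M[R]_(N, d))
    (b : 'cV[R]_N) (r : 'cV[R]_d) : R :=
  ((ones R N)^T *m expv (A *m r + b)) 0 0.

Definition product_form (R : realType) (N d : nat) (A : 'M[R]_(N, d))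
    (b : 'cV[R]_N) (r : 'cV[R]_d) : 'cV[R]_N :=
  (partition_function A b r)^-1 *: expv (A *m r + b).

(* A family of processes with d configurable transition rates.  The generator
   Q is a function of the vector of (positive) configurable rates, whose
   component-wise logarithm is the parameter vector r; how the individual
   entries of the generator depend on these rates is left arbitrary.  pi r is
   the steady-state distribution for the parameter vector r. *)
Definition reversible_process_family (R : realType) (N d : nat)
    (Q : 'cV[R]_d -> 'M[R]_N) (pi : 'cV[R]_d -> 'cV[R]_N) : Prop :=
  forall r : 'cV[R]_d,
    [/\ is_generator (Q (expv r)),
        irreducible_gen (Q (expv r)),
        steady_state (Q (expv r)) (pi r) &
        reversible_gen (Q (expv r)) (pi r)].

Definition achievable (R : realType) (N d : nat) (A : 'M[R]_(N, d))
    (pi : 'cV[R]_d -> 'cV[R]_N) (gamma : 'cV[R]_d) : Prop :=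
  exists ropt : 'cV[R]_d, A^T *m pi ropt = gamma.

Definition open_simplex (R : realType) (N : nat) : set 'cV[R]_N :=
  [set alpha : 'cV[R]_N |
    (forall x, 0 < alpha x 0 < 1) /\ (alpha^T *m ones R N) 0 0 = 1].
Arguments open_simplex R N : clear implicits.

Definition target_region (R : realType) (N d : nat) (A : 'M[R]_(N, d)) :
    set 'cV[R]_d :=
  [set A^T *m alpha | alpha in open_simplex R N].

(* Main.v *)
Require Import Defs.
From HB Require Import structures.
From mathcomp Require Import all_boot all_order all_algebra.
From mathcomp Require Import all_classical all_reals all_analysis.

Set Implicit Arguments.
Unset Strict Implicit.
Unset Printing Implicit Defensive.

Import Order.TTheory GRing.Theory Num.Theory.

Local Open Scope classical_set_scope.
Local Open Scope ring_scope.

Import numFieldNormedType.Exports.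

(** The claim is the classical description of the mean parameters of an
    exponential family.  Let [alpha] be a positive probability vector and let
    [c_i] be the [i]-th row of [A] recentred at the target mean [A^T alpha], so
    that [sum_i alpha_i c_i = 0].  Consider
      [F r = sum_i exp (b_i) * exp (<c_i, r>)],
    which is [exp (- <A^T alpha, r>) * Z r].  Its gradient vanishes at [r]
    exactly when [A^T pi(r) = A^T alpha], so it suffices that [F] attains its
    minimum.

    It does ([exp_sum_min]) because [alpha] is positive: a bound on [F r] bounds
    every [<c_i, r>] from above, since the summands of [F] are positive, and
    then the relation [sum_i alpha_i <c_i, r> = 0] bounds each of them from
    below as well ([exp_sum_sublevel]).  When the rows [c_i] do not span the
    parameter space the sublevel sets of [F] are unbounded, but [F r] depends
    only on the vector of the [<c_i, r>], so the minimisation takes place in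
    the space of these vectors, over a compact box.

    The statement about [B] follows by multiplying [A^T pi(r) = A^T alpha] by
    [B]. *)

Definition exp_sum (R : realType) (N : nat) (w : 'I_N -> R) (u : 'rV[R]_N) : R :=
  \sum_i w i * expR (u 0 i).

Lemma exp_sum_continuous (R : realType) (N : nat) (w : 'I_N -> R)
    (P : 'M[R]_N) :
  continuous (fun u : 'rV[R]_N => exp_sum w (u *m P)).
Proof.
apply: continuous_big => [|i _]; first exact: add_continuous.
have uP : continuous (fun v : 'rV[R]_N => (v *m P) 0 i).
  under [X in continuous X]funext => v do rewrite mxE.
  apply: continuous_big => [|j _ v]; first exact: add_continuous.
  exact: cvgMr_tmp (@coord_continuous R 1 N 0 j v).
have expP : continuous (expR \o (fun v : 'rV[R]_N => (v *m P) 0 i)).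
  by move=> u; apply: continuous_comp; [exact: uP|exact: continuous_expR].
move=> u; exact: cvgMl_tmp (expP u).
Qed.

(** On the hyperplane orthogonal to a positive vector, the sublevel sets of
    [exp_sum w] are bounded.  Each summand is at most the total [c], and
    [x <= expR x] turns this into the upper bound [c / w i]; the orthogonality
    relation converts the upper bounds on the other coordinates into a lower
    bound on the [i]-th. *)
Lemma exp_sum_sublevel (R : realType) (N : nat) (w alpha : 'I_N -> R) (c : R)
    (u : 'rV[R]_N) (i : 'I_N) :
  (forall j, 0 < w j) -> (forall j, 0 < alpha j) ->
  \sum_j alpha j * u 0 j = 0 -> exp_sum w u <= c ->
  - (\sum_j alpha j * (c / w j)) / alpha i <= u 0 i <= c / w i.
Proof.
move=> w_gt0 alpha_gt0 u_orth u_le.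
have u_ub j : u 0 j <= c / w j.
  rewrite ler_pdivlMr // mulrC; apply: le_trans u_le.
  apply: (@le_trans _ _ (w j * expR (u 0 j))).
    rewrite ler_pM2l //; apply: le_trans (expR_ge1Dx _); by rewrite lerDr.
  rewrite /exp_sum (bigD1 j) //= lerDl sumr_ge0 // => k _.
  by rewrite mulr_ge0 ?expR_ge0 // ltW.
have c_ge0 : 0 <= c.
  apply: le_trans u_le; apply: sumr_ge0 => k _.
  by rewrite mulr_ge0 ?expR_ge0 // ltW.
apply/andP; split=> //.
rewrite ler_pdivrMr // lerNl -mulNr mulrC.
have -> : alpha i * - u 0 i = \sum_(j | j != i) alpha j * u 0 j.
  apply/eqP; rewrite mulrN eq_sym -addr_eq0 addrC.
  by move: u_orth; rewrite (bigD1 i) //= => ->.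
apply: (@le_trans _ _ (\sum_(j | j != i) alpha j * (c / w j))).
  by apply: ler_sum => j _; rewrite ler_pM2l.
rewrite [leRHS](bigD1 i) //= lerDr mulr_ge0 ?divr_ge0 //; exact: ltW.
Qed.

(** The positive vector [alpha] annihilated by [D] makes the row space of [D]
    meet the sublevel sets of [exp_sum w] in bounded sets.  The matrix
    [P = pinvmx D *m D] maps every vector into that row space and fixes it
    pointwise, so minimising [u |-> exp_sum w (u *m P)] over a whole box
    replaces minimising over the part of the row space in the box. *)
Lemma exp_sum_min (R : realType) (d N : nat) (D : 'M[R]_(d, N))
    (w alpha : 'I_N -> R) :
  (forall j, 0 < w j) -> (forall j, 0 < alpha j) ->
  D *m (\col_j alpha j) = 0 ->
  exists r0 : 'rV[R]_d, forall r, exp_sum w (r0 *m D) <= exp_sum w (r *m D).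
Proof.
move=> w_gt0 alpha_gt0 D_orth.
set P := pinvmx D *m D.
have PD (r : 'rV_d) : (r *m D) *m P = r *m D by rewrite mulmxA mulmxKpV ?submxMl.
have orth (r : 'rV_d) : \sum_j alpha j * (r *m D) 0 j = 0.
  transitivity (((r *m D) *m (\col_j alpha j)) 0 0).
    by rewrite [RHS]mxE; apply: eq_bigr => j _; rewrite [X in _ = _ * X]mxE mulrC.
  by rewrite -mulmxA D_orth mulmx0 mxE.
(* [c] is the value at [r = 0]: where [exp_sum] exceeds it, there is no
   minimum. *)
set c := exp_sum w (0 *m D).
pose K := [set u : 'rV[R]_N | forall i,
  `[- (\sum_j alpha j * (c / w j)) / alpha i, c / w i]%classic (u ord0 i)].
have K_sub r : exp_sum w (r *m D) <= c -> K (r *m D).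
  by move=> r_le i /=; rewrite in_itv /=; exact: exp_sum_sublevel.
have K0 : K !=set0 by exists (0 *m D); exact: K_sub.
have K_compact : compact K.
  apply: (@rV_compact R N (fun i =>
    `[- (\sum_j alpha j * (c / w j)) / alpha i, c / w i]%classic)) => i.
  exact: segment_compact.
have [u0 _ u0_min] : exists2 u0, u0 \in K & forall u, u \in K ->
    exp_sum w (u0 *m P) <= exp_sum w (u *m P).
  apply: compact_EVT_min => //.
  apply: continuous_subspaceT; exact: exp_sum_continuous.
have u0_le r : exp_sum w (r *m D) <= c ->
    exp_sum w (u0 *m P) <= exp_sum w (r *m D).
  by move=> r_le; rewrite -[in leRHS]PD u0_min // inE; exact: K_sub.
exists (u0 *m pinvmx D) => r; rewrite -mulmxA -/P.
have [/u0_le //|/ltW] := leP (exp_sum w (r *m D)) c.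
by apply: le_trans; exact: u0_le.
Qed.

Lemma exp_sum_critical (R : realType) (N : nat) (w : 'I_N -> R)
    (u v : 'rV[R]_N) :
  (forall t, exp_sum w u <= exp_sum w (u + t *: v)) ->
  \sum_i w i * expR (u 0 i) * v 0 i = 0.
Proof.
move=> u_min.
pose h i (t : R) := w i * expR (u 0 i + t * v 0 i).
have h_derive i (t : R) : is_derive t 1 (h i) (w i * expR (u 0 i + t * v 0 i) * v 0 i).
  rewrite /h; apply: is_derive_eq.
  by rewrite scaler0 !add0r mul1r -[_%:A]/(v 0 i * 1) mulr1 -mulrA.
pose f : R -> R := \sum_i h i.
have fE (t : R) : f t = exp_sum w (u + t *: v).
  by rewrite /f fct_sumE; apply: eq_bigr => i _; rewrite /h !mxE.
have f_derive (t : R) : is_derive t 1 f (\sum_i w i * expR (u 0 i + t * v 0 i) * v 0 i).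
  exact: is_derive_sum.
have mem0 : (0 : R) \in `]-1, 1[ by rewrite in_itv /= ltrN10 ltr01.
have f0 : is_derive (0 : R) 1 f 0.
  apply: (@derive1_at_min R f (-1) 1 0) => //.
  by move=> t _; rewrite !fE scale0r addr0.
rewrite -[RHS](@derive_val _ _ _ _ _ _ _ f0) (@derive_val _ _ _ _ _ _ _ (f_derive 0)).
by apply: eq_bigr => i _; rewrite mul0r addr0.
Qed.

(** The rows of [A] recentred at [A^T *m alpha] are the columns of [D].  With
    weights [expR (b j 0)], the stationarity condition of the corresponding
    exponential sum says that [D] annihilates the unnormalised distribution
    [expv (A *m r + b)], because recentring multiplies all its entries by the
    same positive factor; undoing the recentring brings out the partition
    function. *)
Lemma product_form_moment (R : realType) (N d : nat) (A : 'M[R]_(N, d))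
    (b alpha : 'cV[R]_N) :
  open_simplex R N alpha ->
  exists r : 'cV[R]_d, A^T *m product_form A b r = A^T *m alpha.
Proof.
move=> [alpha01 alpha_sum1].
have alpha_gt0 j : 0 < alpha j 0 by case/andP: (alpha01 j).
set m := A^T *m alpha.
pose D := A^T - m *m (ones R N)^T.
pose w j := expR (b j 0).
have w_gt0 j : 0 < w j by exact: expR_gt0.
have D_orth : D *m (\col_j alpha j 0) = 0.
  have -> : \col_j alpha j 0 = alpha by apply/matrixP => j k; rewrite mxE ord1.
  have one_alpha : (ones R N)^T *m alpha = 1%:M.
    rewrite [LHS]mx11_scalar; congr (_ %:M); rewrite -alpha_sum1.
    by rewrite !mxE; apply: eq_bigr => j _; rewrite !mxE mulrC.
  by rewrite mulmxBl -mulmxA one_alpha mulmx1 subrr.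
have [r0 r0_min] := exp_sum_min w_gt0 alpha_gt0 D_orth.
pose r := r0^T; exists r.
set Z := partition_function A b r.
pose e := expv (A *m r + b).
have ZE : (ones R N)^T *m e = Z%:M by rewrite [LHS]mx11_scalar.
have Z_gt0 : 0 < Z.
  have [j0 _|no_state] := pickP 'I_N; last first.
    move: alpha_sum1; rewrite mxE big_pred0 // => /eqP.
    by rewrite eq_sym oner_eq0.
  rewrite /Z /partition_function mxE (bigD1 j0) //= ltr_wpDr //.
    by apply: sumr_ge0 => j _; rewrite !mxE mul1r expR_ge0.
  by rewrite !mxE mul1r expR_gt0.
suff De : D *m e = 0.
  rewrite /product_form -scalemxAr -/e -/Z.
  have -> : A^T *m e = Z *: m.
    apply/eqP; rewrite -subr_eq0 -mul_mx_scalar -ZE mulmxA -mulmxBl.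
    by rewrite -/D De.
  by rewrite scalerA mulVf ?scale1r ?gt_eqF.
(* Up to the positive factor in [e_tilt], row [k] of [D *m e] is the derivative
   in the [k]-th coordinate direction, whose image under [D] is [row k D]. *)
apply/matrixP => k z; rewrite ord1 mxE [RHS]mxE {z}.
have crit : \sum_i w i * expR ((r0 *m D) 0 i) * (row k D) 0 i = 0.
  apply: exp_sum_critical => t; rewrite rowE scalemxAl -mulmxDl; exact: r0_min.
have e_tilt i : e i 0 = expR ((r0 *m m) 0 0) * (w i * expR ((r0 *m D) 0 i)).
  rewrite /w -!expRD [LHS]mxE [in LHS]mxE; congr expR.
  rewrite addrCA [LHS]addrC; congr (_ + _).
  have -> : (A *m r) i 0 = (r0 *m A^T) 0 i.
    by rewrite -[A]trmxK -trmx_mul mxE trmxK.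
  have -> : A^T = D + m *m (ones R N)^T by rewrite subrK.
  rewrite mulmxDr mulmxA [LHS]mxE addrC; congr (_ + _).
  by rewrite [LHS]mxE big_ord1 !mxE mulr1.
transitivity (expR ((r0 *m m) 0 0) *
   \sum_i w i * expR ((r0 *m D) 0 i) * (row k D) 0 i); last first.
  by rewrite crit mulr0.
rewrite mulr_sumr; apply: eq_bigr => i _.
by rewrite e_tilt [row k D 0 i]mxE [LHS]mulrC !mulrA.
Qed.

Theorem theorem1 (R : realType) (Omega : finType) (d : nat) (d_gt0 : (0 < d)%N)
    (A : 'M[R]_(#|Omega|, d)) (b : 'cV[R]_#|Omega|)
    (Q : 'cV[R]_d -> 'M[R]_#|Omega|) (pi : 'cV[R]_d -> 'cV[R]_#|Omega|)
    (Q_pi : reversible_process_family Q pi)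
    (pi_prod : forall r : 'cV[R]_d, pi r = product_form A b r) :
  (forall gamma : 'cV[R]_d, target_region A gamma -> achievable A pi gamma) /\
  (forall (n : nat) (B : 'M[R]_(n, d)), (n <= d)%N ->
     forall gamma' : 'cV[R]_n,
       [set B *m A^T *m alpha | alpha in open_simplex R #|Omega|] gamma' ->
       exists ropt : 'cV[R]_d, B *m A^T *m pi ropt = gamma').
Proof.
split=> [gamma|n B _ gamma'] [alpha /(product_form_moment A b)[r rE] <-];
  exists r; rewrite pi_prod //.
by rewrite -!mulmxA rE.
Qed.
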